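(* Let $H$ be a separable (real) Hilbert space and let $\mu,\nu\in\mathcal{P}_2(H)$. If $e_{2,2}(\mu,\cdot)=e_{2,2}(\nu,\cdot)+C$ on $H^2$ for some real constant $C$, then $\mu=\nu$ and $C=0$.
   Context: $H$ (finite- or infinite-dimensional) has inner product $(\cdot\mid\cdot)$ and induced norm $|\cdot|$. $\mathcal{P}_2(H)$ is the set of Borel probability measures $\mu$ on $H$ with $\int_H|\xi|^2\mu(d\xi)<+\infty$. For $\mu\in\mathcal{P}_2(H)$ and $(a,b)\in H^2$, $e_{2,2}(\mu,(a,b))=\big[\int_H\min(|\xi-a|^2,|\xi-b|^2)\,\mu(d\xi)\big]^{1/2}$. *)

(* Defs.v *)
From HB Require Import structures.
From mathcomp Require Import all_boot all_order all_algebra.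
From mathcomp Require Import sesquilinear.
From mathcomp Require Import all_classical all_reals all_analysis.
Import Order.TTheory GRing.Theory Num.Theory.
Import numFieldNormedType.Exports.

Set Implicit Arguments.
Unset Strict Implicit.
Unset Printing Implicit Defensive.

Local Open Scope classical_set_scope.
Local Open Scope ring_scope.

Definition separable (T : topologicalType) : Prop :=
  exists D : set T, countable D /\ dense D.

Section quantization.
Context {R : realType} {H : completeNormedModType R}.

Definition borel := g_sigma_algebraType (@open H).

Definition P2 : set (probability borel R) :=
  [set mu | (\int[mu]_(xi in [set: borel]) ((`|xi : H| ^+ 2)%:E) < +oo)%E].

(* The integral is real-valued ([Rintegral], which maps an infinite integral
   to 0). For [mu] in [P2] the integrand is integrable, as it is bounded by
   2|xi|^2 + 2|a|^2, so that no information is lost. *)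
Definition e22 (mu : probability borel R) (ab : H * H) : R :=
  Num.sqrt (\int[mu]_(xi in [set: borel])
    Num.min (`|(xi : H) - ab.1| ^+ 2) (`|(xi : H) - ab.2| ^+ 2)).

End quantization.

Arguments borel {R} H.
Arguments P2 {R} H.

(* Main.v *)
(* Restricting the errors to the line a = b = t u, their squares are quadratic
   polynomials in t with the same leading coefficient |u|^2, which forces C = 0.
   Taking then a = w - v/2 and b = w + v/2, the difference e(a,a)^2 - e(a,b)^2
   is twice the integral of the positive part of (x | v) - (w | v), so mu and nu
   integrate all these hinge functions alike; differentiating in the threshold,
   they agree on half-spaces. The Cramer-Wold step needs no characteristic
   functions: a product of two ridge cosines is a mean of two ridge cosines, so
   ridge cosines belong to an algebra, closed under bounded pointwise limits, of
   functions integrated alike. This algebra contains sgr (sin ((X - c) / n)),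
   since sgr is the limit on [-1, 1] of the iterates of y |-> (3 y - y^3) / 2,
   hence the indicators of half-spaces, and so those of all the sets of the
   sigma-algebra they generate. In a separable Hilbert space, closed balls are
   countable intersections of half-spaces, so that this sigma-algebra is the
   Borel one. *)
Require Import Defs.
From HB Require Import structures.
From mathcomp Require Import all_boot all_order all_algebra.
From mathcomp Require Import sesquilinear.
From mathcomp Require Import all_classical all_reals all_analysis.
From mathcomp Require Import measurable_realfun ring lra.
Import Order.TTheory GRing.Theory Num.Theory.
Import numFieldNormedType.Exports.

Set Implicit Arguments.
Unset Strict Implicit.
Unset Printing Implicit Defensive.

Local Open Scope classical_set_scope.
Local Open Scope ring_scope.

(** * Bounded measurable functions and bounded convergence *)

Section bounded_measurable.
Context d {T : measurableType d} {R : realType}.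
Implicit Types (f g : T -> R) (m : probability T R).

Definition bdd_measurable f :=
  measurable_fun setT f /\ exists B, forall x, `|f x| <= B.

Lemma bdd_measurable_integrable m f :
  bdd_measurable f -> m.-integrable setT (EFin \o f).
Proof.
move=> [mf [B fB]]; apply: measurable_bounded_integrable => //.
  exact: fin_num_fun_lty.
exists B; split; rewrite ?num_real// => x Bx y _ /=.
exact: le_trans (fB y) (ltW Bx).
Qed.

Lemma bdd_measurable_cst (k : R) : bdd_measurable (fun=> k).
Proof. by split; [exact: measurable_cst|exists `|k|]. Qed.

Lemma bdd_measurableD f g : bdd_measurable f -> bdd_measurable g ->
  bdd_measurable (fun x => f x + g x).
Proof.
move=> [mf [B fB]] [mg [C gC]]; split; first exact: measurable_funD.
by exists (B + C) => x; rewrite (le_trans (ler_normD _ _))// lerD.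
Qed.

Lemma bdd_measurableM f g : bdd_measurable f -> bdd_measurable g ->
  bdd_measurable (fun x => f x * g x).
Proof.
move=> [mf [B fB]] [mg [C gC]]; split; first exact: measurable_funM.
by exists (B * C) => x; rewrite normrM ler_pM.
Qed.

Lemma bdd_measurable_lim (f_ : (T -> R)^nat) f B :
  (forall n, measurable_fun setT (f_ n)) -> (forall n x, `|f_ n x| <= B) ->
  (forall x, f_ ^~ x @ \oo --> f x) -> bdd_measurable f.
Proof.
move=> mf fB ff; split; first by apply: measurable_fun_cvg => // x _; exact: ff.
exists B => x; have /cvg_norm fx := ff x.
rewrite -(cvg_lim _ fx)//; apply: limr_le.
  by apply/cvg_ex; eexists; exact: fx.
by apply: nearW => n; exact: fB.
Qed.

Lemma Rintegral_bdd_cvg m (f_ : (T -> R)^nat) f B :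
  (forall n, measurable_fun setT (f_ n)) -> (forall n x, `|f_ n x| <= B) ->
  (forall x, f_ ^~ x @ \oo --> f x) ->
  \int[m]_x f_ n x @[n --> \oo] --> \int[m]_x f x.
Proof.
move=> mf fB ff; have bf := bdd_measurable_lim mf fB ff.
apply/fine_cvg; rewrite fineK; last first.
  by apply: integrable_fin_num => //; exact: bdd_measurable_integrable.
apply: (@dominated_cvg _ _ _ m _ _ (fun n x => (f_ n x)%:E) _ (cst B%:E)) => //.
- by move=> n; apply/measurable_EFinP.
- by move=> x _; apply: cvg_EFin; [exact: nearW|exact: ff].
- exact: (bdd_measurable_integrable _ (bdd_measurable_cst B)).
- by move=> n x _ /=; rewrite lee_fin.
Qed.

End bounded_measurable.

(** * The algebra and the sigma-algebra of multipliers *)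

Section multipliers.
Context d {T : measurableType d} {R : realType}.
Variables (mu nu : probability T R) (C : set (T -> R)).
Implicit Types (f g h : T -> R).
Hypothesis bddC : forall h, C h -> bdd_measurable h.

Definition same_integral f := \int[mu]_x f x = \int[nu]_x f x.

(** These are the densities [g] for which [g mu] and [g nu] integrate each member of [C] alike. *)
Definition undistinguished g :=
  bdd_measurable g /\ forall h, C h -> same_integral (fun x => g x * h x).

(* Unlike the functions with equal integrals, the multipliers are stable under
   products, whatever C is. *)
Definition multiplier h := bdd_measurable h /\
  forall g, undistinguished g -> undistinguished (fun x => g x * h x).

Lemma same_integralD f g : bdd_measurable f -> bdd_measurable g ->
  same_integral f -> same_integral g -> same_integral (fun x => f x + g x).
Proof.
move=> bf bg fE gE; rewrite /same_integral !RintegralD ?fE ?gE//;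
  exact: bdd_measurable_integrable.
Qed.

Lemma same_integralZ f k : bdd_measurable f ->
  same_integral f -> same_integral (fun x => k * f x).
Proof.
move=> bf fE; rewrite /same_integral !RintegralZl ?fE//;
  exact: bdd_measurable_integrable.
Qed.

Lemma same_integral_lim (f_ : (T -> R)^nat) f B :
  (forall n, measurable_fun setT (f_ n)) -> (forall n x, `|f_ n x| <= B) ->
  (forall x, f_ ^~ x @ \oo --> f x) -> (forall n, same_integral (f_ n)) ->
  same_integral f.
Proof.
move=> mf fB ff fE.
have h1 := Rintegral_bdd_cvg (m := mu) mf fB ff.
have := Rintegral_bdd_cvg (m := nu) mf fB ff.
rewrite -(funext fE) => h2; exact: (cvg_unique _ h1 h2).
Qed.

Lemma multiplier_cst k : multiplier (fun=> k).
Proof.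
split=> [|g [bg gE]]; first exact: bdd_measurable_cst.
split=> [|h Ch]; first exact/bdd_measurableM/bdd_measurable_cst.
under [fun x => _]eq_fun do rewrite mulrAC mulrC.
by apply: same_integralZ; [apply: bdd_measurableM => //; exact: bddC|exact: gE].
Qed.

Lemma multiplierD h k : multiplier h -> multiplier k ->
  multiplier (fun x => h x + k x).
Proof.
move=> [bh hE] [bk kE]; split=> [|g gu]; first exact: bdd_measurableD.
have [bg _] := gu; have [bgh ghE] := hE _ gu; have [bgk gkE] := kE _ gu.
split=> [|c Cc]; first exact/bdd_measurableM/bdd_measurableD.
under [fun x => _]eq_fun do rewrite mulrDr mulrDl.
have bc := bddC Cc.
by apply: same_integralD; [exact: bdd_measurableM..|exact: ghE|exact: gkE].
Qed.

Lemma multiplierM h k : multiplier h -> multiplier k ->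
  multiplier (fun x => h x * k x).
Proof.
move=> [bh hE] [bk kE]; split=> [|g gu]; first exact: bdd_measurableM.
under [fun x => _]eq_fun do rewrite mulrA.
exact/kE/hE.
Qed.

Lemma multiplierZ (k : R) h : multiplier h -> multiplier (fun x => k * h x).
Proof. by apply: multiplierM; exact: multiplier_cst. Qed.

(** Dominated convergence applies to [g * f_ n * h], because [g] and [h] are bounded as well. *)
Lemma multiplier_lim (f_ : (T -> R)^nat) f B :
  (forall n, multiplier (f_ n)) -> (forall n x, `|f_ n x| <= B) ->
  (forall x, f_ ^~ x @ \oo --> f x) -> multiplier f.
Proof.
move=> fm fB ff.
have mf n : measurable_fun setT (f_ n) by have [[]] := fm n.
have bf := bdd_measurable_lim mf fB ff.
split=> // g gu; split=> [|h Ch].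
  by apply: bdd_measurableM => //; case: gu.
have [[mg [Bg gB]] _] := gu; have [mh [Bh hB]] := bddC Ch.
apply: (@same_integral_lim (fun n x => g x * f_ n x * h x) _ (Bg * B * Bh)).
- by move=> n; do 2 apply: measurable_funM => //.
- by move=> n x; rewrite !normrM !ler_pM// mulr_ge0.
- move=> x; apply: cvgM; last exact: cvg_cst.
  by apply: cvgM; [exact: cvg_cst|exact: ff].
- by move=> n; have [_ /(_ _ gu)[_]] := fm n; apply.
Qed.

Definition multiplier_sets : set (set T) :=
  [set A | measurable A /\ multiplier (\1_A)].

Lemma multiplier_sets_setC A : multiplier_sets A -> multiplier_sets (~` A).
Proof.
move=> [mA Am]; split; first exact: measurableC.
have -> : \1_(~` A) = (fun x => 1 + -1 * \1_A x) :> (T -> R).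
  apply/funext => x; rewrite !indicE in_setC; case: (x \in A) => /=; lra.
by apply: multiplierD; [exact: multiplier_cst|exact: multiplierZ].
Qed.

Lemma multiplier_sets_setI A B : multiplier_sets A -> multiplier_sets B ->
  multiplier_sets (A `&` B).
Proof.
move=> [mA Am] [mB Bm]; split; first exact: measurableI.
by rewrite indicI; exact: multiplierM.
Qed.

(** The finite intersections are multiplier sets, and at each point their indicators are eventually
    constant, equal to that of the full intersection. *)
Lemma multiplier_sets_bigcap (A : (set T)^nat) :
  (forall n, multiplier_sets (A n)) -> multiplier_sets (\bigcap_n A n).
Proof.
move=> Am; split; first by apply: bigcapT_measurable => n; have [] := Am n.
pose B n := \bigcap_(k < n) A k.
have Bm n : multiplier_sets (B n).
  elim: n => [|n IH].
    rewrite /B bigcap_mkord big_ord0; split=> //.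
    by rewrite indicT; exact: multiplier_cst.
  rewrite /B bigcap_mkord big_ord_recr/= -bigcap_mkord.
  exact: multiplier_sets_setI.
apply: (@multiplier_lim (fun n => \1_(B n)) _ 1).
- by move=> n; have [] := Bm n.
- by move=> n x; rewrite indicE; case: (_ \in _); rewrite ?normr1 ?normr0.
- move=> x; apply: cvg_near_cst.
  have [Ax|/existsNP[k /not_implyP[_ Akx]]] := pselect ((\bigcap_n A n) x).
    apply: nearW => n; rewrite !indicE !mem_set// => k _; exact: Ax.
  exists k.+1 => // n /= kn; rewrite !indicE !memNset// => h; first exact/Akx/h.
  exact/Akx/h.
Qed.

Lemma multiplier_sets_sigma_algebra : sigma_algebra setT multiplier_sets.
Proof.
split.
- by split=> //; rewrite indic0; exact: multiplier_cst.
- by move=> A; rewrite setTD; exact: multiplier_sets_setC.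
- move=> A Am; rewrite -(setCK (\bigcup__ _)) setC_bigcup.
  apply: multiplier_sets_setC; apply: multiplier_sets_bigcap => n.
  exact: multiplier_sets_setC.
Qed.

Lemma multiplier_sets_measure (A : set T) : C (fun=> 1) ->
  (forall h, C h -> same_integral h) -> multiplier_sets A -> mu A = nu A.
Proof.
move=> C1 CE [mA [bA AE]].
have u1 : undistinguished (fun=> 1).
  split=> [|h Ch]; first exact: bdd_measurable_cst.
  by under [fun x => _]eq_fun do rewrite mul1r; exact: CE.
(* The multiplier [\1_A] is applied to the density 1 and tested against the member 1 of [C]. *)
have [_ /(_ _ C1)] := AE _ u1.
under [fun x => _]eq_fun do rewrite mul1r mulr1.
rewrite /same_integral /Rintegral !integral_indic// !setIT => /eqP.
by rewrite -eqe !fineK ?fin_num_measure// => /eqP.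
Qed.

End multipliers.

(** * The sign as a limit of polynomial iterates *)

Section sign_iteration.
Context {R : realType}.
Implicit Types y : R.

(** An odd polynomial with fixed points -1, 0 and 1: the derivative vanishes at -1 and 1, which
    attract, and is 3/2 at 0, which repels. *)
Definition cubic_step y := (3 * y - y ^+ 3) / 2.

Lemma cubic_stepN y : cubic_step (- y) = - cubic_step y.
Proof. by rewrite /cubic_step; field. Qed.

Lemma iter_cubic_stepN n y : iter n cubic_step (- y) = - iter n cubic_step y.
Proof. by elim: n => //= n ->; exact: cubic_stepN. Qed.

Lemma iter_cubic_step_itv n y : 0 <= y <= 1 -> y <= iter n cubic_step y <= 1.
Proof.
move=> /andP[y0 y1]; elim: n => [|n /andP[] /=]; first by rewrite lexx.
move: (iter _ _ _) => z yz z1; have z0 : 0 <= z by exact: le_trans yz.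
apply/andP; split.
  apply: (le_trans yz); rewrite -subr_ge0.
  have -> : cubic_step z - z = z * (1 - z) * (1 + z) / 2.
    by rewrite /cubic_step; field.
  by rewrite divr_ge0// !mulr_ge0//; lra.
rewrite -subr_ge0.
have -> : 1 - cubic_step z = (1 - z) ^+ 2 * (z + 2) / 2.
  by rewrite /cubic_step; field.
by rewrite divr_ge0// mulr_ge0// ?sqr_ge0//; lra.
Qed.

Lemma norm_iter_cubic_step n y : `|y| <= 1 -> `|iter n cubic_step y| <= 1.
Proof.
wlog y0 : y / 0 <= y => [hw y1|].
  have [/hw|/ltW y0] := leP 0 y; first exact.
  by rewrite -(opprK y) iter_cubic_stepN normrN hw ?normrN// oppr_ge0.
rewrite ger0_norm// => y1; have y01 : 0 <= y <= 1 by rewrite y0.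
have /andP[yz z1] := iter_cubic_step_itv n y01.
by rewrite ger0_norm// (le_trans y0).
Qed.

(** One step from [z] multiplies the gap [1 - z] by [1 - (z + z ^+ 2) / 2], which is at most
    [1 - y / 2] because the iterates stay above [y]. *)
Lemma iter_cubic_step_rate n y : 0 <= y <= 1 ->
  1 - iter n cubic_step y <= (1 - y / 2) ^+ n.
Proof.
move=> y01; elim: n => [|n IH] /=; first by rewrite expr0; lra.
have := iter_cubic_step_itv n y01.
move: IH; move: (iter n _ y) => z IH /andP[yz z1].
rewrite exprS; have /andP[y0 y1] := y01.
apply: (@le_trans _ _ ((1 - y / 2) * (1 - z))); last first.
  by rewrite ler_wpM2l//; lra.
have -> : 1 - cubic_step z = (1 - z) * (1 - (z + z ^+ 2) / 2).
  by rewrite /cubic_step; field.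
rewrite mulrC ler_wpM2r ?subr_ge0//.
have := sqr_ge0 z; lra.
Qed.

Lemma cvg_iter_cubic_step y : `|y| <= 1 ->
  iter n cubic_step y @[n --> \oo] --> Num.sg y.
Proof.
wlog y0 : y / 0 <= y => [hw y1|].
  have [/hw|/ltW y0] := leP 0 y; first exact.
  rewrite -(opprK y) sgrN; under eq_fun do rewrite iter_cubic_stepN.
  by apply: cvgN; apply: hw; rewrite ?normrN// oppr_ge0.
rewrite ger0_norm// => y1.
(* At 0 the geometric ratio would be 1; but 0 is a fixed point, in accordance with [sgr0]. *)
have [->|yn0] := eqVneq y 0.
  rewrite sgr0; under eq_fun => n.
    have -> : iter n cubic_step 0 = 0 :> R.
      by elim: n => //= n ->; rewrite /cubic_step expr0n/= mulr0 subr0 mul0r.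
    over.
  exact: cvg_cst.
have yp : 0 < y by rewrite lt_neqAle eq_sym yn0.
have y01 : 0 <= y <= 1 by rewrite y0.
rewrite gtr0_sg//.
apply: (@squeeze_cvgr _ _ _ _ (fun n => 1 - (1 - y / 2) ^+ n) (fun=> 1)).
- apply: nearW => n; have := iter_cubic_step_rate n y01.
  have /andP[_ ->] := iter_cubic_step_itv n y01; rewrite andbT; lra.
- rewrite -[X in _ --> X]subr0; apply: cvgB; first exact: cvg_cst.
  by apply: cvg_expr; rewrite ger0_norm; lra.
- exact: cvg_cst.
Qed.

End sign_iteration.

(** The iterates of [cubic_step] at [h] are polynomials in [h], hence multipliers; they stay in
    [-1, 1] and converge to the sign. *)
Lemma multiplier_sgr d (T : measurableType d) (R : realType)
    (mu nu : probability T R) (C : set (T -> R)) (h : T -> R) :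
  (forall f, C f -> bdd_measurable f) ->
  (forall x, `|h x| <= 1) -> multiplier mu nu C h ->
  multiplier mu nu C (fun x => Num.sg (h x)).
Proof.
move=> bC h1 hm.
apply: (@multiplier_lim _ _ _ _ _ _ bC
  (fun n x => iter n cubic_step (h x)) _ 1).
- elim=> [|n IH] //=; rewrite /cubic_step.
  have -> : (fun x =>
      (3 * iter n cubic_step (h x) - iter n cubic_step (h x) ^+ 3) / 2) =
      (fun x => 3 / 2 * iter n cubic_step (h x) +
        - 2^-1 * (iter n cubic_step (h x) * (iter n cubic_step (h x) *
          iter n cubic_step (h x)))).
    by apply/funext => x; field.
  apply: multiplierD => //; apply: multiplierZ => //.
  by do 2 apply: multiplierM => //.
- by move=> n x; exact: norm_iter_cubic_step.
- by move=> x; exact: cvg_iter_cubic_step.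
Qed.

(** * From half-spaces to the sigma-algebra they generate *)

Lemma probability_eq_rays (R : realType)
    (m1 m2 : {measure set R -> \bar R}) :
  (forall c, (m1 `]c, +oo[%classic < +oo)%E) ->
  (forall c, m1 `]c, +oo[%classic = m2 `]c, +oo[%classic) ->
  forall A, measurable A -> m1 A = m2 A.
Proof.
move=> m1y m12 A mA.
apply: (@measure_unique _ R _ (@RGenOInfty.G R)
  (fun n => `](- n%:R), +oo[%classic) _ _ _ _ m1 m2 _ _ A mA) => //.
- exact: RGenOInfty.measurableE.
(* The open rays are stable under intersection. *)
- move=> _ _ [x ->] [y ->]; exists (Num.max x y).
  by apply/seteqP; split=> z /=; rewrite !in_itv/= !andbT gt_max => /andP.
- by move=> n; exists (- n%:R).
- apply/seteqP; split=> // x _; exists (Num.truncn `|x|).+1 => //=.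
  rewrite in_itv/= andbT ltrNl.
  by apply: le_lt_trans (Num.Theory.truncnS_gt _); rewrite -normrN ler_norm.
- by move=> _ [x ->].
Qed.

Section cramer_wold.
Context d {T : measurableType d} {R : realType} {V : lmodType R}.
Variables (mu nu : probability T R) (X : V -> T -> R).
Hypothesis mX : forall v, measurable_fun setT (X v).
Hypothesis XD : forall u v x, X (u + v) x = X u x + X v x.
Hypothesis XZ : forall a v x, X (a *: v) x = a * X v x.
Hypothesis halfspaceE : forall v c,
  mu [set x | c < X v x] = nu [set x | c < X v x].

(** The phase [c] makes the ridge sines members too, and [v = 0] gives the constant 1. *)
Definition ridge_cosines : set (T -> R) :=
  [set h | exists v c, h = fun x => cos (X v x + c)].

Lemma ridge_cosines_bdd h : ridge_cosines h -> bdd_measurable h.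
Proof.
move=> [v [c ->]]; split; last by exists 1 => x; exact: cos_max.
apply: measurableT_comp; last exact: measurable_funD.
by apply: continuous_measurable_fun; exact: continuous_cos.
Qed.

(** A ridge cosine depends on [x] through [X v x] alone, and the masses of half-spaces determine the
    law of [X v] on the real line. *)
Lemma ridge_cosines_same_integral h : ridge_cosines h -> same_integral mu nu h.
Proof.
move=> hC; have bh := ridge_cosines_bdd hC; case: hC bh => v [c ->] bh.
have mcos : measurable_fun [set: R] (fun r => (cos (r + c))%:E).
  apply/measurable_EFinP; apply: measurableT_comp; last exact: measurable_funD.
  by apply: continuous_measurable_fun; exact: continuous_cos.
have pf (m : probability T R) :
    (\int[m]_x (cos (X v x + c))%:E =
     \int[pushforward m (X v)]_r (cos (r + c))%:E)%E.
  rewrite integral_pushforward//; exact: bdd_measurable_integrable.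
rewrite /same_integral /Rintegral !pf; congr fine.
apply: eq_measure_integral => A mA _.
apply: probability_eq_rays mA => [r|r].
  rewrite /= /pushforward (le_lt_trans (probability_le1 _ _)) ?ltry//.
  by rewrite -[Y in measurable Y]setTI; exact: mX.
rewrite /= /pushforward.
have -> : X v @^-1` `]r, +oo[ = [set x | r < X v x].
  by apply/seteqP; split=> x /=; rewrite in_itv/= andbT.
exact: halfspaceE.
Qed.

Let mult := multiplier mu nu ridge_cosines.

(** By the product formula, testing [g] times a ridge cosine against a ridge cosine is the mean of
    two tests of [g], in the directions [v + w] and [v - w]. *)
Lemma ridge_cosine_multiplier v c : mult (fun x => cos (X v x + c)).
Proof.
have bvc u a : bdd_measurable (fun x => cos (X u x + a)).
  by apply: ridge_cosines_bdd; exists u, a.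
split=> // g [bg gE]; split=> [|_ [w [e ->]]]; first exact: bdd_measurableM.
have -> : (fun x => g x * cos (X v x + c) * cos (X w x + e)) = (fun x =>
    2^-1 * (g x * cos (X (v + w) x + (c + e))) +
    2^-1 * (g x * cos (X (v + -1 *: w) x + (c - e)))).
  apply/funext => x; rewrite !XD XZ.
  have -> : X v x + X w x + (c + e) = X v x + c + (X w x + e) by ring.
  have -> : X v x + -1 * X w x + (c - e) = X v x + c - (X w x + e) by ring.
  by rewrite cosB (cosD (X v x + c) (X w x + e)); field.
apply: same_integralD.
- exact/bdd_measurableM/bdd_measurableM/bvc/bg/bdd_measurable_cst.
- exact/bdd_measurableM/bdd_measurableM/bvc/bg/bdd_measurable_cst.
- by apply: same_integralZ; [exact/bdd_measurableM/bvc|apply: gE; do 2 eexists].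
- by apply: same_integralZ; [exact/bdd_measurableM/bvc|apply: gE; do 2 eexists].
Qed.

Lemma halfspace_multiplier v c :
  multiplier_sets mu nu ridge_cosines [set x | c < X v x].
Proof.
split.
  rewrite -[X in measurable X]setTI.
  have -> : [set x | c < X v x] = X v @^-1` `]c, +oo[.
    by apply/seteqP; split=> x /=; rewrite in_itv/= andbT.
  exact: mX.
have sm : mult (fun x => Num.sg (X v x - c)).
  apply: (@multiplier_lim _ _ _ _ _ _ ridge_cosines_bdd
    (fun n x => Num.sg (sin ((X v x - c) / n.+1%:R))) _ 1).
  - move=> n; apply: multiplier_sgr => [h|x|].
    + exact: ridge_cosines_bdd.
    + exact: sin_max.
    (* The sine is a cosine delayed by a quarter period, and the factor [n.+1%:R^-1] is absorbed in
       the direction. *)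
    have -> : (fun x => sin ((X v x - c) / n.+1%:R)) =
        (fun x => cos (X (n.+1%:R^-1 *: v) x + (- (c / n.+1%:R) - pi / 2))).
      by apply/funext => x; rewrite XZ addrA cosBpihalf; congr sin; field.
    exact: ridge_cosine_multiplier.
  - by move=> n x; rewrite normr_sg; case: (_ == 0).
  - move=> x; set y := X v x - c; apply: cvg_near_cst.
    (* From this index on [y / n.+1%:R] lies in ]-1, 1[, hence in ]-pi, pi[, where the sine has the
       sign of its argument. *)
    exists (Num.truncn `|y|) => // n /= yn.
    have yn1 : `|y| < n.+1%:R.
      by apply: lt_le_trans (Num.Theory.truncnS_gt _) _; rewrite ler_nat ltnS.
    have sgp (z : R) : 0 < z -> z < n.+1%:R -> Num.sg (sin (z / n.+1%:R)) = 1.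
      move=> z0 zn; rewrite gtr0_sg// sin_gt0_pi// divr_gt0//=.
      rewrite ltr_pdivrMr// (lt_le_trans zn)// ler_peMl//.
      by have := @pi_ge2 R; lra.
    have [y0|y0|->] := ltgtP y 0; last by rewrite mul0r sin0.
      rewrite (ltr0_sg y0) -[y]opprK mulNr sinN sgrN sgp ?oppr_gt0//.
      by rewrite -(ltr0_norm y0).
    by rewrite (gtr0_sg y0) sgp// -(gtr0_norm y0).
(* For a sign [s], the value [(s + s * s) / 2] is 1 if [s = 1], and 0 if [s] is 0 or -1. *)
have -> : \1_[set x | c < X v x] = (fun x => 2^-1 *
    (Num.sg (X v x - c) + Num.sg (X v x - c) * Num.sg (X v x - c))) :> (T -> R).
  apply/funext => x; rewrite indicE; have [cx|cx] := ltP c (X v x).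
    by rewrite mem_set// gtr0_sg ?subr_gt0// [LHS](_ : _ = 1)//; lra.
  rewrite memNset/=; last by apply/negP; rewrite -leNgt.
  move: cx; rewrite le_eqVlt => /predU1P[->|cx].
    by rewrite subrr sgr0; lra.
  by rewrite ltr0_sg ?subr_lt0//; lra.
apply: multiplierZ; first exact: ridge_cosines_bdd.
apply: multiplierD => //; first exact: ridge_cosines_bdd.
exact: multiplierM.
Qed.

(** Half-spaces are in general not stable under intersection, so agreement on them does not extend
    by a pi-system argument. The multiplier sets, however, form a sigma-algebra containing them. *)
Theorem cramer_wold (A : set T) :
  <<s [set A | exists v c, A = [set x | c < X v x]] >> A -> mu A = nu A.
Proof.
move=> hA; apply: (multiplier_sets_measure (C := ridge_cosines)).
- exists 0, 0; apply/funext => x; have := XZ 0 0 x; rewrite scale0r mul0r => ->.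
  by rewrite addr0 cos0.
- exact: ridge_cosines_same_integral.
- apply: (smallest_sub _ _ hA).
    exact: multiplier_sets_sigma_algebra ridge_cosines_bdd.
  by move=> _ [v [c ->]]; exact: halfspace_multiplier.
Qed.

End cramer_wold.

(** * From hinge functions to half-spaces *)

(** The difference quotient of the hinges at [c] and [c + n.+1%:R^-1] is a ramp with values in
    [0, 1], and the ramps tend to the indicator of [c < X x]. Integrability of [X] lets the integral
    of the quotient be split. *)
Lemma hinge_halfspace d (T : measurableType d) (R : realType)
    (mu nu : probability T R) (X : T -> R) :
  measurable_fun setT X ->
  mu.-integrable setT (EFin \o X) -> nu.-integrable setT (EFin \o X) ->
  (forall c, same_integral mu nu (fun x => Num.max 0 (X x - c))) ->
  forall c, mu [set x | c < X x] = nu [set x | c < X x].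
Proof.
move=> mX imu inu hE c.
pose hinge (a : R) x : R := Num.max 0 (X x - a).
have mhinge a : measurable_fun setT (hinge a).
  by apply: measurable_maxr => //; exact: measurable_funB.
have ihinge (m : probability T R) a : m.-integrable setT (EFin \o X) ->
    m.-integrable setT (EFin \o hinge a).
  move=> iX; apply: (@le_integrable _ _ _ m _ _ _
    (EFin \o (fun x => `|X x| + `|a|))) => //.
  - exact/measurable_EFinP.
  - move=> x _; rewrite /= lee_fin [leRHS]ger0_norm ?addr_ge0// /hinge.
    rewrite ger0_norm ?le_max ?lexx// ge_max addr_ge0//=.
    by rewrite lerD ?ler_norm// -normrN ler_norm.
  - have -> : EFin \o (fun x => `|X x| + `|a|) =
        ((abse \o (EFin \o X)) \+ (cst `|a|%:E))%E by apply/funext.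
    apply: integrableD => //; first exact: integrable_abse.
    exact: (bdd_measurable_integrable _ (bdd_measurable_cst _)).
pose f n x : R := n.+1%:R * (hinge c x - hinge (c + n.+1%:R^-1) x).
have fE n x : f n x = if X x <= c then 0 else
    if X x <= c + n.+1%:R^-1 then n.+1%:R * (X x - c) else 1.
  have : 0 < n.+1%:R :> R by [].
  rewrite /f /hinge; move: (n.+1%:R : R) (X x) => N z N0.
  have n0 : 0 < N^-1 by rewrite invr_gt0.
  case: (leP z c) => h1.
    by rewrite !(elimT max_idPl) ?subrr ?mulr0//; lra.
  rewrite (elimT (@max_idPr _ _ 0 (z - c))); last lra.
  case: (leP z) => h2.
    by rewrite (elimT max_idPl) ?subr0//; lra.
  rewrite (elimT max_idPr); last lra.
  by field; lra.
have mf n : measurable_fun setT (f n).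
  by apply: measurable_funM => //; apply: measurable_funB; exact: mhinge.
have S : same_integral mu nu \1_[set x | c < X x].
  apply: (@same_integral_lim _ _ _ mu nu f _ 1) => //.
  - move=> n x; rewrite fE; case: (leP (X x) c) => h1; first by rewrite normr0.
    case: (leP (X x) (c + _)) => h2; last by rewrite normr1.
    rewrite ger0_norm ?mulr_ge0//; last lra.
    by rewrite mulrC -ler_pdivlMr// mul1r lerBlDl.
  - move=> x; apply: cvg_near_cst; rewrite indicE.
    have [cx|cx] := ltP c (X x); last first.
      rewrite memNset/=; last by apply/negP; rewrite -leNgt.
      by apply: nearW => n; rewrite fE cx.
    rewrite mem_set//; have d0 : 0 < (X x - c)^-1 by rewrite invr_gt0 subr_gt0.
    (* From this index on [n.+1%:R^-1 < X x - c], so that the ramp has already reached 1 at [x]. *)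
    exists (Num.truncn (X x - c)^-1) => // n /= dn.
    have dn1 : (X x - c)^-1 < n.+1%:R.
      by apply: lt_le_trans (Num.Theory.truncnS_gt _) _; rewrite ler_nat ltnS.
    rewrite fE !ifF//; apply/negbTE; rewrite -ltNge//.
    by rewrite -ltrBrDl -[ltRHS]invrK ltf_pV2 ?posrE.
  - move=> n; rewrite /same_integral /f !RintegralZl//; first last.
    + apply: (@integrableB _ _ _ _ _ _ (EFin \o _) (EFin \o _)) => //;
        exact: ihinge.
    + apply: (@integrableB _ _ _ _ _ _ (EFin \o _) (EFin \o _)) => //;
        exact: ihinge.
    by rewrite !RintegralB ?hE//; exact: ihinge.
have mA : measurable [set x | c < X x].
  rewrite -[Y in measurable Y]setTI.
  have -> : [set x | c < X x] = X @^-1` `]c, +oo[.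
    by apply/seteqP; split=> x /=; rewrite in_itv/= andbT.
  exact: mX.
move: S => /eqP.
rewrite /same_integral /Rintegral !integral_indic// !setIT.
by rewrite -eqe !fineK ?fin_num_measure// => /eqP.
Qed.

(** * Inner product, continuity and integrability *)

Section inner_product.
Context {R : realType} {H : completeNormedModType R}.
Variable ip : {dot H for (idfun : R -> R)}.
Hypothesis norm_ip : forall x : H, `|x| = Num.sqrt (ip x x).
Implicit Types (x y u v : H) (m : probability (borel H) R).

Lemma ipC x y : ip x y = ip y x.
Proof. by rewrite (hermC (theta := idfun) ip) expr0 mul1r. Qed.

Lemma ipZl a x y : ip (a *: x) y = a * ip x y.
Proof. by rewrite linearZl_LR. Qed.

Lemma ipDl x y v : ip (x + y) v = ip x v + ip y v.
Proof. by rewrite linearDl. Qed.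

Lemma ipNl x y : ip (- x) y = - ip x y.
Proof. by rewrite linearNl. Qed.

Lemma ipDr x y v : ip v (x + y) = ip v x + ip v y.
Proof. by rewrite linearDr. Qed.

Lemma ipNr x y : ip x (- y) = - ip x y.
Proof. by rewrite linearNr. Qed.

Lemma ipZr a x y : ip x (a *: y) = a * ip x y.
Proof. by rewrite ipC ipZl ipC. Qed.

Lemma ip_norm x : ip x x = `|x| ^+ 2.
Proof.
rewrite norm_ip sqr_sqrtr//; have [->|x0] := eqVneq x 0.
  by rewrite linear0l.
exact/ltW/neq0_dnorm_gt0.
Qed.

Lemma sqr_normD x y : `|x + y| ^+ 2 = `|x| ^+ 2 + 2 * ip x y + `|y| ^+ 2.
Proof. by rewrite -!ip_norm ipDl !ipDr (ipC y x); ring. Qed.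

Lemma sqr_normB x y : `|x - y| ^+ 2 = `|x| ^+ 2 - 2 * ip x y + `|y| ^+ 2.
Proof. by rewrite sqr_normD normrN ipNr mulrN. Qed.

(** Cauchy-Schwarz follows from the triangle inequality of the norm on squaring both sides. *)
Lemma ip_le x y : ip x y <= `|x| * `|y|.
Proof.
have : `|x + y| ^+ 2 <= (`|x| + `|y|) ^+ 2.
  by rewrite ler_sqr ?nnegrE ?addr_ge0// ler_normD.
rewrite sqr_normD sqrrD; lra.
Qed.

Lemma norm_ip_le x y : `|ip x y| <= `|x| * `|y|.
Proof.
by rewrite ler_norml ip_le lerNl -ipNl -[`|x|]normrN ip_le.
Qed.

Lemma continuous_ipl v : continuous (ip ^~ v).
Proof.
move=> x; apply/cvgrPdist_lt => e e0.
have v0 : 0 < `|v| + 1 by rewrite ltr_pwDr.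
near=> y; rewrite -ipNl -ipDl (le_lt_trans (norm_ip_le _ _))//.
apply: (@le_lt_trans _ _ (`|x - y| * (`|v| + 1))).
  by rewrite ler_wpM2l// lerDl.
rewrite -ltr_pdivlMr//; near: y.
apply: (@cvgr_dist_lt _ _ _ (nbhs x) _ id x); first exact: cvg_id.
by rewrite divr_gt0.
Unshelve. all: by end_near. Qed.

Lemma continuous_borel_measurable (f : H -> R) :
  continuous f -> measurable_fun [set: borel H] (f : borel H -> R).
Proof.
move=> /continuousP cf; apply: (measurability _ (RGenOInfty.measurableE R)).
move=> _ [_ [x ->] <-]; rewrite setTI; apply: sub_sigma_algebra.
exact/cf/interval_open.
Qed.

(** Membership in [P2] makes the squared norm integrable, and constants are integrable for a
    probability. *)
Lemma integrable_quadratic_growth m (f : H -> R) (k : R) : P2 H m ->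
  measurable_fun [set: borel H] (f : borel H -> R) ->
  (forall x, `|f x| <= k * (`|x| ^+ 2 + 1)) ->
  m.-integrable [set: borel H] (EFin \o f).
Proof.
move=> m2 mf fk.
have cn : continuous (fun x : H => `|x| ^+ 2 : R).
  by move=> x; apply: cvgM; apply: cvg_norm; exact: cvg_id.
have isq : m.-integrable [set: borel H] (EFin \o (fun x : H => `|x| ^+ 2)).
  apply/integrableP; split.
    by apply/measurable_EFinP; have := continuous_borel_measurable cn; exact.
  by under eq_integral do rewrite /= ger0_norm ?sqr_ge0//.
apply: (@le_integrable _ _ _ m _ _ _
  (EFin \o (fun x : H => k * (`|x| ^+ 2 + 1)))) => //.
- exact/measurable_EFinP.
- by move=> x _ /=; rewrite lee_fin (le_trans (fk _))// ler_norm.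
- apply: (@integrableZl _ _ _ m _ _ k
    (EFin \o (fun x : H => `|x| ^+ 2 + 1))) => //.
  apply: (@integrableD _ _ _ m _ _ (EFin \o _) (EFin \o (fun=> 1))) => //.
  exact: (bdd_measurable_integrable _ (bdd_measurable_cst _)).
Qed.

Lemma continuous_sqr_dist (a : H) : continuous (fun x : H => `|x - a| ^+ 2).
Proof.
move=> x; apply: cvgM; apply: cvg_norm;
  by apply: cvgB; [exact: cvg_id|exact: cvg_cst].
Qed.

Lemma sqr_dist_growth (a x : H) :
  `|x - a| ^+ 2 <= (2 + 2 * `|a| ^+ 2) * (`|x| ^+ 2 + 1).
Proof.
rewrite sqr_normB.
have := sqr_ge0 `|x|; have := sqr_ge0 `|a|; have := sqr_ge0 (`|x| - `|a|).
have /ler_normlP[h _] := norm_ip_le x a.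
rewrite sqrrB; nra.
Qed.

End inner_product.

(** * Half-spaces generate the Borel sets of a separable Hilbert space *)

Lemma separable_dense_sequence (T : ptopologicalType) : separable T ->
  exists s : nat -> T, forall O, O !=set0 -> open O -> exists n, O (s n).
Proof.
move=> [D [/countable_injP[f finj] dD]].
(* The sequence inverts the injection [f] of [D] into the naturals; an index outside its image gets
   the default [point], which does not affect density. *)
exists (fun n => xget point [set x | D x /\ f x = n]) => O O0 oO.
have [x [Ox Dx]] := dD _ O0 oO; exists (f x).
have [Dy fy] := @xgetPex _ point [set y | D y /\ f y = f x]
  (ex_intro _ x (conj Dx erefl)).
by rewrite (finj _ _ _ _ fy)// inE.
Qed.

Section borel_halfspaces.
Context {R : realType} {H : completeNormedModType R}.
Variable ip : {dot H for (idfun : R -> R)}.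
Hypothesis norm_ip : forall x : H, `|x| = Num.sqrt (ip x x).
Hypothesis sepH : separable H.

Definition halfspaces : set (set H) :=
  [set A | exists v c, A = [set x | c < ip x v]].

Let mT := g_sigma_algebraType halfspaces.

(** The ball is cut out by the inequalities [ip (x - a) d <= r * |d|] for [d] in a dense sequence.
    If [x] is outside, the reverse strict inequality holds at [d = x - a], hence, being an open
    condition, at some term of the sequence. *)
Lemma closed_ball_halfspaces (a : H) r : 0 <= r ->
  <<s halfspaces >> [set x | `|x - a| <= r].
Proof.
move=> r0; have [s sd] := separable_dense_sequence sepH.
have -> : [set x | `|x - a| <= r] =
    \bigcap_n ~` [set x | r * `|s n| + ip a (s n) < ip x (s n)].
  apply/seteqP; split=> x /= h.
    move=> n _ /=; apply/negP; rewrite -leNgt -lerBlDr -ipNl -ipDl.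
    by rewrite (le_trans (ip_le norm_ip _ _))// ler_wpM2r.
  rewrite leNgt; apply/negP => xr; set y := x - a.
  have cg : continuous (fun d : H => ip y d - r * `|d|).
    move=> d; apply: cvgB.
      have -> : ip y = ip ^~ y by apply/funext => z; rewrite ipC.
      exact: continuous_ipl.
    by apply: cvgM; [exact: cvg_cst|apply: cvg_norm; exact: cvg_id].
  have [||n] := sd ((fun d : H => ip y d - r * `|d|) @^-1` [set z | 0 < z]).
  - exists y => /=.
    rewrite (ip_norm norm_ip) expr2 -mulrBl mulr_gt0 ?subr_gt0//.
    exact: le_lt_trans xr.
  - by move/continuousP : cg; apply; exact: open_gt.
  - move=> /=; apply/negP; rewrite -leNgt subr_le0 /y ipDl ipNl lerBlDr leNgt.
    by apply/negP; exact: h.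
apply: (@bigcapT_measurable _ mT) => n.
apply: (@measurableC _ mT); apply: sub_sigma_algebra.
by exists (s n), (r * `|s n| + ip a (s n)).
Qed.

Lemma open_halfspaces (U : set H) : open U -> <<s halfspaces >> U.
Proof.
move=> oU; have [s sd] := separable_dense_sequence sepH.
pose B n k := [set x : H | `|x - s k| <= n.+1%:R^-1].
(* With a radius below [e / 2], a closed ball whose centre is that close to [x] contains [x] and
   stays within [e] of it. *)
have -> : U = \bigcup_n \bigcup_(k in [set k | B n k `<=` U]) B n k.
  apply/seteqP; split=> [x Ux|x [n _ [k /=]]]; last exact.
  have /nbhs_ballP[e /= e0 eU] := open_nbhs_nbhs (conj oU Ux).
  pose n := Num.truncn (2 / e).
  have n2 : 2 / e < n.+1%:R := Num.Theory.truncnS_gt _.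
  have {}n2 : n.+1%:R^-1 < e / 2.
    by rewrite -[ltRHS]invrK invf_div ltf_pV2 ?posrE// divr_gt0.
  have n0 : 0 < n.+1%:R^-1 :> R by rewrite invr_gt0.
  have [||k] := sd (ball x n.+1%:R^-1).
  - by exists x; exact: ballxx.
  - exact: ball_open.
  rewrite -ball_normE /= => xk; exists n => //; exists k => /=; last exact: ltW.
  move=> y; rewrite /B /= => yk; apply: eU; rewrite -ball_normE /=.
  have -> : x - y = (x - s k) - (y - s k) by rewrite opprB addrA subrK.
  rewrite (le_lt_trans (ler_normB _ _))// [e]splitr ltrD//.
    exact: lt_trans n2.
  exact: le_lt_trans n2.
apply: (@bigcupT_measurable _ mT) => n; apply: (@bigcup_measurable _ mT) => k _.
exact: closed_ball_halfspaces.
Qed.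

End borel_halfspaces.

(** * Rigidity of square roots of quadratic polynomials *)

(** In [f ^+ 2 - g ^+ 2 = 2 * C * g + C ^+ 2] the leading terms cancel on the left, so if [C] is
    nonzero then [g] is affine. Being nonnegative it is constant, against [0 < A]. *)
Lemma quadratic_squares_shift_eq0 (R : realType) (f g : R -> R)
    (A p p' M M' C : R) :
  0 < A -> (forall t, 0 <= g t) ->
  (forall t, f t ^+ 2 = A * t ^+ 2 - 2 * t * p + M) ->
  (forall t, g t ^+ 2 = A * t ^+ 2 - 2 * t * p' + M') ->
  (forall t, f t = g t + C) -> C = 0.
Proof.
move=> A0 g0 fE gE fgC; apply/eqP; apply: contraT => C0.
have affine t : 2 * C * g t = 2 * (p' - p) * t + (M - M' - C ^+ 2).
  have := fE t; rewrite fgC sqrrD gE => h; lra.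
have [pp|pp] := eqVneq (p' - p) 0.
  have gc t : g t = g 0.
    apply: (@mulfI _ (2 * C)); first by rewrite mulf_neq0.
    by rewrite !affine pp !mulr0 !mul0r.
  (* The second difference of the constant [g ^+ 2] would be [2 * A]. *)
  have := gE 0; have := gE 1; have := gE (-1); rewrite (gc 1) (gc (-1)).
  move=> h1 h2 h3; nra.
(* This is where the affine function [2 * C * g] equals [- C], making [g] negative. *)
pose t := (- C - (M - M' - C ^+ 2)) / (2 * (p' - p)).
have gt : g t = - 2^-1.
  apply: (@mulfI _ (2 * C)); first by rewrite mulf_neq0.
  by rewrite affine /t; field.
by have := g0 t; rewrite gt; lra.
Qed.

(** * Quadratic and hinge formulas for the quantization error *)

Section quantization_error.
Context {R : realType} {H : completeNormedModType R}.
Variable ip : {dot H for (idfun : R -> R)}.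
Hypothesis norm_ip : forall x : H, `|x| = Num.sqrt (ip x x).
Implicit Type m : probability (borel H) R.

Lemma sqr_e22 m (ab : H * H) : e22 m ab ^+ 2 =
  \int[m]_(x in [set: borel H])
    Num.min (`|(x : H) - ab.1| ^+ 2) (`|(x : H) - ab.2| ^+ 2).
Proof.
rewrite /e22 sqr_sqrtr//; apply: Rintegral_ge0 => x _.
by rewrite le_min !sqr_ge0.
Qed.

Lemma measurable_sqr_dist (a : H) :
  measurable_fun [set: borel H] ((fun x => `|x - a| ^+ 2) : borel H -> R).
Proof. exact: (continuous_borel_measurable (@continuous_sqr_dist _ _ a)). Qed.

Lemma integrable_sqr_dist m (a : H) : P2 H m ->
  m.-integrable [set: borel H] (EFin \o (fun x : H => `|x - a| ^+ 2)).
Proof.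
move=> m2; apply: (integrable_quadratic_growth m2 (measurable_sqr_dist a)) => x.
rewrite ger0_norm ?sqr_ge0//; exact: (sqr_dist_growth norm_ip).
Qed.

Lemma integrable_min_sqr_dist m (a b : H) : P2 H m ->
  m.-integrable [set: borel H]
    (EFin \o (fun x : H => Num.min (`|x - a| ^+ 2) (`|x - b| ^+ 2))).
Proof.
move=> m2.
apply: (integrable_quadratic_growth m2 (k := 2 + 2 * `|a| ^+ 2)) => [|x].
  by apply: measurable_minr; exact: measurable_sqr_dist.
rewrite ger0_norm ?le_min ?sqr_ge0// ge_min.
by rewrite (sqr_dist_growth norm_ip).
Qed.

Lemma measurable_ipl v : measurable_fun [set: borel H] (ip ^~ v : borel H -> R).
Proof.
exact: (continuous_borel_measurable (continuous_ipl norm_ip (v := v))).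
Qed.

Lemma integrable_ipl m v : P2 H m ->
  m.-integrable [set: borel H] (EFin \o (ip ^~ v)).
Proof.
move=> m2; apply: (integrable_quadratic_growth m2 (k := `|v|)) => [|x].
  exact: measurable_ipl.
rewrite (le_trans (norm_ip_le norm_ip _ _))// mulrC ler_wpM2l//.
have := sqr_ge0 (`|x| - 1); rewrite sqrrB1; have := sqr_ge0 `|x|; lra.
Qed.

(** With equal centres the minimum is a single squared distance, expanded under the integral. The
    leading coefficient is independent of [m] because the total mass is 1. *)
Lemma sqr_e22_line m (u : H) t : P2 H m ->
  e22 m (t *: u, t *: u) ^+ 2 = `|u| ^+ 2 * t ^+ 2 -
    2 * t * \int[m]_(x in [set: borel H]) ip x u +
    \int[m]_(x in [set: borel H]) `|x : H| ^+ 2.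
Proof.
move=> m2; rewrite sqr_e22.
have i2 := integrable_sqr_dist 0 m2.
have iu := integrable_ipl u m2.
have i1 : m.-integrable [set: borel H] (EFin \o (fun x : H => `|x| ^+ 2)).
  by under [_ \o _]eq_fun do rewrite -[X in `|X|]subr0.
have ic k : m.-integrable [set: borel H] (EFin \o (fun=> k)).
  exact: (bdd_measurable_integrable _ (bdd_measurable_cst _)).
have iZ : m.-integrable [set: borel H]
    (EFin \o (fun x : H => - (2 * t) * ip x u)).
  exact: (@integrableZl _ _ _ m _ _ (- (2 * t)) (EFin \o (ip ^~ u))).
under eq_Rintegral => x _.
  rewrite minxx (sqr_normB norm_ip) ipZr normrZ exprMn real_normK ?num_real//.
  rewrite (_ : _ - _ + _ = t ^+ 2 * `|u| ^+ 2 +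
    (- (2 * t) * ip x u + `|x : H| ^+ 2)); last ring.
  over.
rewrite RintegralD//; last first.
  exact: (@integrableD _ _ _ m _ _ (EFin \o _) (EFin \o _)).
rewrite RintegralD// Rintegral_cst// [X in fine X](_ : _ = 1%E); last first.
  exact: probability_setT.
by rewrite (@RintegralZl _ _ _ m _ (ip ^~ u))//=; ring.
Qed.

(** For the squared distances [p] and [q] to the two centres, [p - q] is [2 * (ip x v - ip w v)],
    and [p - min p q = max 0 (p - q)]. *)
Lemma hinge_sqr_e22 m (v w : H) : P2 H m ->
  2 * \int[m]_(x in [set: borel H]) Num.max 0 (ip x v - ip w v) =
  e22 m (w - 2^-1 *: v, w - 2^-1 *: v) ^+ 2 -
  e22 m (w - 2^-1 *: v, w + 2^-1 *: v) ^+ 2.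
Proof.
move=> m2; rewrite !sqr_e22/= -RintegralB//; try exact: integrable_min_sqr_dist.
have dist x : `|x - (w - 2^-1 *: v)| ^+ 2 - `|x - (w + 2^-1 *: v)| ^+ 2 =
    2 * (ip x v - ip w v).
  rewrite !(sqr_normB norm_ip) (sqr_normD norm_ip).
  by rewrite !ipDr ipNr !ipZr; field.
have -> : \int[m]_(x in [set: borel H]) Num.max 0 (ip x v - ip w v) =
    \int[m]_(x in [set: borel H]) (2^-1 *
      (Num.min (`|x - (w - 2^-1 *: v)| ^+ 2) (`|x - (w - 2^-1 *: v)| ^+ 2) -
       Num.min (`|x - (w - 2^-1 *: v)| ^+ 2) (`|x - (w + 2^-1 *: v)| ^+ 2))).
  apply: eq_Rintegral => x _; rewrite minxx.
  have := dist x.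
  set p := `|x - (w - _)| ^+ 2; set q := `|x - (w + _)| ^+ 2 => pq.
  have [?|?] := leP p q.
    by rewrite (elimT max_idPl); lra.
  by rewrite (elimT max_idPr); lra.
rewrite RintegralZl//; first by field.
by apply: (@integrableB _ _ _ m _ _ (EFin \o _) (EFin \o _)) => //;
  exact: integrable_min_sqr_dist.
Qed.

End quantization_error.

(** * Vanishing of the constant and equality of the measures *)

Lemma e22_eq_constant (R : realType) (H : completeNormedModType R)
    (ip : {dot H for (idfun : R -> R)})
    (norm_ip : forall x : H, `|x| = Num.sqrt (ip x x))
    (mu nu : probability (borel H) R) (mu2 : P2 H mu) (nu2 : P2 H nu)
    (C : R) (eC : forall ab : H * H, e22 mu ab = e22 nu ab + C) : C = 0.
Proof.
have [[u u0]|H0] := pselect (exists u : H, u != 0).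
  apply: (@quadratic_squares_shift_eq0 R (fun t => e22 mu (t *: u, t *: u))
    (fun t => e22 nu (t *: u, t *: u))) (fun t => sqrtr_ge0 _)
    (fun t => sqr_e22_line norm_ip u t mu2)
    (fun t => sqr_e22_line norm_ip u t nu2) (fun t => eC _).
  by rewrite exprn_gt0// normr_gt0.
(* Here [H] is the zero space and offers no line; both errors vanish at the origin. *)
have e0 (m : probability (borel H) R) : e22 m (0, 0) = 0.
  rewrite /e22 (_ : Rintegral _ _ _ = 0) ?sqrtr0//.
  rewrite -[RHS](mul0r (fine (m [set: borel H]))) -Rintegral_cst//.
  apply: eq_Rintegral => x _.
  rewrite minxx subr0; have [->|x0] := eqVneq (x : H) 0.
    by rewrite normr0 expr0n.
  by case: H0; exists x.
by have := eC (0, 0); rewrite !e0 add0r => <-.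
Qed.

Theorem proposition3p1 (R : realType) (H : completeNormedModType R)
    (ip : {dot H for (idfun : R -> R)})
    (norm_ip : forall x : H, `|x| = Num.sqrt (ip x x))
    (sepH : separable H)
    (mu nu : probability (borel H) R) (mu2 : P2 H mu) (nu2 : P2 H nu)
    (C : R) (eC : forall ab : H * H, e22 mu ab = e22 nu ab + C) :
  (forall A : set (borel H), measurable A -> mu A = nu A) /\ C = 0.
Proof.
have C0 := e22_eq_constant norm_ip mu2 nu2 eC; split=> // A mA.
have hinges v c : same_integral mu nu (fun x : H => Num.max 0 (ip x v - c)).
  (* For [v = 0] the hinge is a constant, which all probabilities integrate alike. *)
  have [->|v0] := eqVneq v 0.
    have -> : (fun x : H => Num.max 0 (ip x 0 - c)) = (fun=> Num.max 0 (- c)).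
      by apply/funext => x; rewrite linear0r sub0r.
    rewrite /same_integral !Rintegral_cst//; congr (_ * fine _).
    by rewrite [LHS]probability_setT; apply/esym/probability_setT.
  (* Moving the midpoint [w] along [v] realises every threshold [c] as [ip w v]. *)
  pose w := (c / `|v| ^+ 2) *: v.
  have wv : ip w v = c.
    by rewrite ipZl (ip_norm norm_ip) divfK// expf_eq0/= normr_eq0.
  apply: (@mulfI _ 2) => //; rewrite -wv !(hinge_sqr_e22 norm_ip)//.
  by rewrite !eC C0 !addr0.
apply: (@cramer_wold _ (borel H) R H mu nu (fun v x => ip x v)).
- exact: measurable_ipl.
- by move=> u v x; exact: ipDr.
- by move=> a v x; exact: ipZr.
- move=> v; apply: hinge_halfspace; first exact: measurable_ipl.
  + exact: integrable_ipl.
  + exact: integrable_ipl.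
  + exact: hinges.
- apply: (smallest_sub _ _ mA); first exact: smallest_sigma_algebra.
  by move=> U /(open_halfspaces norm_ip sepH).
Qed.
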